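(* Let $X$ be a Cantor set and $\mathcal{G}\subset\mathrm{Homeo}(X)$ be an ample group with Property E. Suppose $H$ is a maximal subgroup of $\mathcal{G}$ that acts minimally on $X$ and contains the local subgroup $\mathcal{G}_U$ for some nonempty clopen set $U\subset X$. Then $H=\mathrm{St}_{\mathcal{G}}(U_1,U_2,\dots,U_k)$ for some partition $X=U_1\sqcup U_2\sqcup\dots\sqcup U_k$ into nonempty clopen sets. Moreover, the partition is unique, it consists of at least two sets, and the induced action of $H$ on the set $\{U_1,U_2,\dots,U_k\}$ is transitive.
   Context: $\mathrm{Homeo}(X)$ is the group of all homeomorphisms of $X$. For a group $G\subset\mathrm{Homeo}(X)$, its full amplification $\mathsf{F}(G)$ is the group of all homeomorphisms $f$ of $X$ such that every point $x\in X$ has an open neighborhood $U_x$ on which $f$ coincides with some element of $G$. The group $G$ is called ample if $\mathsf{F}(G)=G$. A group acts minimally on $X$ if the only closed invariant subsets are $\emptyset$ and $X$. For a clopen (closed and open) set $U\subset X$, the local subgroup $\mathcal{G}_U$ consists of all $g\in\mathcal{G}$ such that $g(x)=x$ for all $x\notin U$. Property E for the ample group $\mathcal{G}$: for any clopen sets $V_1,V_2\subset X$ with $V_1\cap V_2\ne\emptyset$, the group $\mathcal{G}_{V_1\cup V_2}$ is generated by $\mathcal{G}_{V_1}\cup\mathcal{G}_{V_2}$. $\mathrm{St}_{\mathcal{G}}(U_1,\dots,U_k)$ consists of those $g\in\mathcal{G}$ that map each set $U_i$ onto some (the same or another) set $U_j$. A maximal subgroup of $\mathcal{G}$ is a proper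 subgroup $H$ such that there is no subgroup $K$ with $H\subsetneq K\subsetneq\mathcal{G}$. *)

(* Defs.v *)
From mathcomp Require Import all_boot.
From mathcomp Require Import boolp classical_sets functions topology cantor.
Set Implicit Arguments.
Unset Strict Implicit.
Unset Printing Implicit Defensive.
Local Open Scope classical_set_scope.

Definition homeomorphism (X Y : topologicalType) (f : X -> Y) : Prop :=
  continuous f /\
  exists g : Y -> X, [/\ continuous g, cancel f g & cancel g f].

(* [cantor_like] alone would not do: over an arbitrary [topologicalType] it
   also admits the empty space and non-metrizable spaces. *)
Definition cantor_set (X : topologicalType) : Prop :=
  exists f : X -> cantor_space, homeomorphism f.

Definition Homeo (X : topologicalType) : set (X -> X) :=
  [set f | homeomorphism f].
Arguments Homeo : clear implicits.

Section Groups_of_homeomorphisms.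
Variable X : topologicalType.
Implicit Types (G H K : set (X -> X)) (U V : set X).

Definition homeo_group G : Prop :=
  [/\ G `<=` Homeo X,
      G id,
      (forall f g, G f -> G g -> G (f \o g)) &
      (forall f g, G f -> cancel f g -> cancel g f -> G g)].

Definition full_amplification G : set (X -> X) :=
  [set f | Homeo X f /\
    forall x, exists U, [/\ open U, U x &
      exists2 g, G g & forall y, U y -> f y = g y]].

Definition ample G : Prop := full_amplification G = G.

Definition acts_minimally G : Prop :=
  forall C : set X, closed C -> (forall g, G g -> g @` C `<=` C) ->
    C = set0 \/ C = [set: X].

Definition local_subgroup G U : set (X -> X) :=
  [set g | G g /\ forall x, ~ U x -> g x = x].

Definition generated_group (S : set (X -> X)) : set (X -> X) :=
  smallest homeo_group S.

Definition property_E G : Prop :=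
  forall V1 V2, clopen V1 -> clopen V2 -> V1 `&` V2 !=set0 ->
    local_subgroup G (V1 `|` V2) =
    generated_group (local_subgroup G V1 `|` local_subgroup G V2).

Definition maximal_subgroup G H : Prop :=
  [/\ homeo_group H, H `<` G &
      ~ exists K, [/\ homeo_group K, H `<` K & K `<` G]].

Definition St G (k : nat) (U : 'I_k -> set X) : set (X -> X) :=
  [set g | G g /\ forall i, exists j, g @` U i = U j].

(* [partition] includes the nonemptiness of the pieces. *)
Definition clopen_partition (k : nat) (U : 'I_k -> set X) : Prop :=
  partition [set: 'I_k] U [set: X] /\ forall i, clopen (U i).

Definition transitive_on_pieces H (k : nat) (U : 'I_k -> set X) : Prop :=
  forall i j, exists2 h, H h & h @` U i = U j.

End Groups_of_homeomorphisms.

(* Main.v *)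
(** Call a clopen set V good when G_V is contained in H.  Minimality of H and
    compactness yield a finite cover of X by good sets, and Property E makes the
    union of two intersecting good sets good.  Hence "x and y lie in a common
    good set" is an equivalence relation with finitely many classes, each of
    which is a good clopen set, and H permutes the classes.

    Conversely, if G_C permutes the pieces of a clopen partition and C contains
    two pieces A and B, then G_C preserves A: for a proper nonempty clopen W in
    B, the group G_C is generated by its local subgroups over A `|` W and over
    C `\` A.  An element of the first fixes a point of every piece other than A,
    and the second fixes A pointwise.  With C = X this shows that the stabilizer
    of the classes is not G, so it equals H by maximality; with C a class it
    shows, ampleness providing elements of G_C that move A, that no finer
    partition has the same stabilizer. *)
Require Import Defs.
From mathcomp Require Import all_boot.
From mathcomp Require Import boolp classical_sets functions topology cantor.
Local Open Scope classical_set_scope.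

(** * Splitting and compactness of Cantor sets, carried over from [cantor_space] *)

Section CantorSet.
Variable X : topologicalType.
Hypothesis cantorX : cantor_set X.

(** Perfectness gives two distinct points in the open image of [B], and zero-dimensionality
    separates them by a clopen set. *)
Lemma cantor_set_split (B : set X) : clopen B -> B !=set0 ->
  exists W : set X, [/\ clopen W, W !=set0, W `<=` B & B `\` W !=set0].
Proof.
move=> cB [b Bb]; have [f [cf [g [cg fK gK]]]] := cantorX.
have oB : open (g @^-1` B) by move/continuousP : cg; apply; case: cB.
have [|x [y [Bx By xy]]] := perfectTP_ex.1 cantor_perfect _ oB.
  by exists (f b); rewrite /preimage /= fK.
have [W [cW Wx nWy]] := cantor_zero_dimensional xy.
exists (B `&` f @^-1` W); split.
- exact/clopenI/(preimage_clopen cW).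
- by exists (g x); split=> //; rewrite /preimage /= gK.
- by move=> z [].
- by exists (g y); split=> // -[_]; rewrite /preimage /= gK.
Qed.

Lemma cantor_set_subcover (V : X -> set X) :
  (forall x, open (V x)) -> (forall x, V x x) ->
  exists s : seq X, forall z, exists2 y, y \in s & V y z.
Proof.
move=> oV Vxx; have [f [cf [g [cg fK gK]]]] := cantorX.
have := cantor_space_compact; rewrite compact_cover.
move=> /(_ X setT (fun x => g @^-1` V x)) [||D _ covD].
- by move=> x _; move/continuousP : cg; apply.
- by move=> z _; exists (g z) => //; exact: Vxx.
- exists (finmap.enum_fset D) => z; have [//|y Dy Vyz] := covD (f z).
  by exists y => //; move: Vyz; rewrite /preimage /= fK.
Qed.

End CantorSet.

(** * Groups of homeomorphisms and their local subgroups *)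

Section HomeoGroups.
Variables (X : topologicalType) (G : set (X -> X)).
Hypothesis grG : homeo_group G.

Lemma homeo_groupV g : G g ->
  exists g', [/\ G g', continuous g', cancel g g' & cancel g' g].
Proof.
have [GX _ _ Ginv] := grG.
by move=> Gg; have [_ [g' [cg' gK g'K]]] := GX _ Gg;
  exists g'; split=> //; exact: Ginv gK g'K.
Qed.

Lemma homeo_group_inj g : G g -> injective g.
Proof. by move=> /homeo_groupV[g' [_ _ gK _]]; exact: can_inj gK. Qed.

Lemma homeo_group_imageE g (V : set X) : G g ->
  exists2 g', continuous g' & g @` V = g' @^-1` V.
Proof.
move=> /homeo_groupV[g' [_ cg' gK g'K]]; exists g' => //.
apply/seteqP; split=> [_ [x Vx <-]|x Vx]; first by rewrite /preimage /= gK.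
by exists (g' x).
Qed.

Lemma homeo_group_image_open g (V : set X) : G g -> open V -> open (g @` V).
Proof. by move=> /(homeo_group_imageE _ V)[g' /continuousP cg' ->]; exact: cg'. Qed.

Lemma homeo_group_image_clopen g (V : set X) : G g -> clopen V -> clopen (g @` V).
Proof. by move=> /(homeo_group_imageE _ V)[g' cg' ->] cV; exact: preimage_clopen. Qed.

Lemma local_subgroup_image (H : set (X -> X)) h (V : set X) :
  homeo_group H -> H `<=` G -> H h ->
  local_subgroup G V `<=` H -> local_subgroup G (h @` V) `<=` H.
Proof.
move=> grH HG Hh VH g [Gg gfix].
have [_ _ Gcomp _] := grG; have [_ _ Hcomp Hinv] := grH.
have [h' [Gh' _ hK h'K]] := homeo_groupV _ (HG _ Hh).
have Hh' : H h' := Hinv _ _ Hh hK h'K.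
have Hc : H (h' \o (g \o h)).
  apply: VH; split; first by apply: (Gcomp) => //; apply: (Gcomp) => //; exact: HG.
  move=> x Vx; rewrite /= gfix ?hK // => -[y Vy /(can_inj hK) yx].
  by apply: Vx; rewrite -yx.
have -> : g = h \o ((h' \o (g \o h)) \o h').
  by apply/funext => x /=; rewrite !h'K.
by apply: (Hcomp) => //; apply: (Hcomp).
Qed.

End HomeoGroups.

Lemma set_stabilizer_group (X : topologicalType) (A : set X) :
  homeo_group [set g : X -> X | Homeo X g /\ g @` A = A].
Proof.
split.
- by move=> g [].
- split; last exact: image_id.
  by split; [move=> x; exact: cvg_id|exists id; split=> // x; exact: cvg_id].
- move=> f g [[cf [f' [cf' fK f'K]]] fA] [[cg [g' [cg' gK g'K]]] gA].
  split; last by rewrite -image_comp gA fA.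
  split; first by move=> x; apply: continuous_comp; [exact: cg|exact: cf].
  exists (g' \o f'); split.
  + by move=> x; apply: continuous_comp; [exact: cf'|exact: cg'].
  + exact: can_comp.
  + exact: can_comp.
- move=> f g [[cf [f' [cf' fK f'K]]] fA] fgK gfK.
  (* Only [f'] is known to be continuous; inverses being unique, it is [g]. *)
  have <- : f' = g by apply/funext => x; rewrite -{1}[x]gfK fK.
  split; first by split=> //; exists f.
  by rewrite -[in LHS]fA image_comp (_ : f' \o f = id) ?image_id//; exact/funext.
Qed.

(** Applied with [K] equal to [H], for unions of good sets, and with [K] the stabilizer of a
    piece. *)
Lemma property_E_sub (X : topologicalType) (G K : set (X -> X)) (V1 V2 : set X) :
  property_E G -> homeo_group K -> clopen V1 -> clopen V2 ->
  V1 `&` V2 !=set0 ->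
  local_subgroup G V1 `<=` K -> local_subgroup G V2 `<=` K ->
  local_subgroup G (V1 `|` V2) `<=` K.
Proof.
move=> EG grK c1 c2 V12 V1K V2K; rewrite EG //.
by apply: smallest_sub => // g [/V1K|/V2K].
Qed.

(** * Stabilizers of clopen partitions *)

Section ClopenPartition.
Variables (X : topologicalType) (k : nat) (P : 'I_k -> set X).
Hypothesis partP : clopen_partition P.

Lemma clopen_partition_cover x : exists i, P i x.
Proof.
have [[cov _ _] _] := partP.
by have : [set: X] x by []; rewrite -cov => -[i _ Pix]; exists i.
Qed.

Lemma clopen_partition_eq i j x : P i x -> P j x -> i = j.
Proof. by have [[_ triv _] _] := partP => Pix Pjx; apply: triv => //; exists x. Qed.

Lemma St_image (G : set (X -> X)) g i j x :
  St G P g -> P i x -> P j (g x) -> g @` P i = P j.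
Proof.
move=> [_ /(_ i)[l gil]] Pix Pjgx; rewrite gil; congr (P _).
by apply: clopen_partition_eq Pjgx; rewrite -gil; exists x.
Qed.

Lemma St_group (G : set (X -> X)) : homeo_group G -> homeo_group (St G P).
Proof.
move=> [GX Gid Gcomp Ginv]; have [[_ _ ne] _] := partP; split.
- by move=> g [/GX].
- by split=> // i; exists i; exact: image_id.
- move=> f g [Gf fP] [Gg gP]; split=> [|i]; first exact: Gcomp.
  by have [j gij] := gP i; have [l fjl] := fP j; exists l; rewrite -image_comp gij.
- move=> f g Stf fK gK; split; first by case: Stf => Gf _; exact: Ginv fK gK.
  move=> i; have [x Pix] := ne i I; have [j Pjgx] := clopen_partition_cover (g x).
  exists j; rewrite -(St_image _ _ j i (g x) Stf) ?gK//.
  by rewrite image_comp (_ : g \o f = id) ?image_id//; exact/funext.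
Qed.

Lemma local_subgroup_piece_sub_St (G : set (X -> X)) i :
  homeo_group G -> local_subgroup G (P i) `<=` St G P.
Proof.
move=> grG g [Gg gfix]; split=> // j; exists j.
have [g' [_ _ gK g'K]] := homeo_groupV _ _ grG _ Gg.
(* If [g x] left [P i], it would be fixed by [g], and injectivity would give [g x = x]. *)
have gP x : P i x <-> P i (g x).
  split=> [Px|Pgx]; apply: contrapT => nP; apply: (nP).
    by rewrite (homeo_group_inj _ _ grG _ Gg _ _ (gfix _ nP)).
  by rewrite -(gfix _ nP).
have gPj x : P j x <-> P j (g x).
  have [<-//|nij] := pselect (i = j).
  split=> Pj.
    by rewrite gfix// => Pi; apply/nij/clopen_partition_eq/Pj.
  have nPi : ~ P i x by move/gP => Pi; apply/nij/clopen_partition_eq/Pj.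
  by rewrite -(gfix _ nPi).
apply/seteqP; split=> [_ [x Pjx <-]|x Pjx]; first exact: (gPj x).1.
by exists (g' x); rewrite ?g'K//; apply: (gPj _).2; rewrite g'K.
Qed.

Lemma local_subgroup_preserves_piece (G : set (X -> X)) (C : set X) a b :
  cantor_set X -> homeo_group G -> property_E G ->
  clopen C -> P a `<=` C -> P b `<=` C -> a <> b ->
  local_subgroup G C `<=` St G P ->
  forall g, local_subgroup G C g -> g @` P a = P a.
Proof.
move=> cX grG EG cC aC bC nab CSt.
have [[_ _ ne] cP] := partP; have [GX _ _ _] := grG.
have [W [cW [w Ww] WB [z [Bz nWz]]]] := cantor_set_split _ cX _ (cP b) (ne b I).
have disj x : P a x -> ~ P b x.
  by move=> Pa Pb; apply: nab; exact: clopen_partition_eq Pa Pb.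
(* The two sets overlap exactly in [W], so Property E applies to them. *)
have CE : C = (P a `|` W) `|` (C `\` P a).
  apply/seteqP; split=> [x Cx|x [[/aC|/WB/bC]|[]]]//.
  by have [Pa|nPa] := pselect (P a x); [left; left|right].
suff : local_subgroup G C `<=` [set g | Homeo X g /\ g @` P a = P a].
  by move=> sub g /sub[].
rewrite [X in local_subgroup G X]CE.
apply: property_E_sub => //.
- exact: set_stabilizer_group.
- by apply: clopenU.
- by rewrite setDE; apply: clopenI => //; apply: clopenC.
- by exists w; split; [right|split; [exact/bC/WB|move=> /disj; apply; exact: WB]].
- move=> g [Gg gfix]; split; first exact: GX.
  have gC : local_subgroup G C g.
    by split=> // x nCx; apply: gfix => -[/aC|/WB/bC].
  have [_ /(_ a)[j gaj]] := CSt _ gC.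
  have [aj|naj] := pselect (a = j); first by rewrite gaj -aj.
  (* Piece [b] retains the fixed point [z] because [W] is a proper subset; a piece other than [a]
     and [b] is fixed pointwise. A fixed point in [P j] must come from itself, hence cannot lie in
     the image of [P a]. *)
  have [y [Pjy gy]] : exists y, P j y /\ g y = y.
    have [<-|nbj] := pselect (b = j).
      by exists z; split=> //; apply: gfix => -[/disj|].
    have [y Pjy] := ne j I; exists y; split=> //; apply: gfix.
    case=> [Pay|/WB Pby].
      by apply/naj/clopen_partition_eq/Pjy.
    by apply/nbj/clopen_partition_eq/Pjy.
  have : (g @` P a) y by rewrite gaj.
  move=> [x Pax gxy]; have xy : x = y.
    by apply: (homeo_group_inj _ _ grG _ Gg); rewrite gxy gy.
  by exfalso; apply/naj/(clopen_partition_eq _ _ y) => //; rewrite -xy.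
- move=> g [Gg gfix]; split; first exact: GX.
  have fixa x : P a x -> g x = x by move=> Pax; apply: gfix => -[].
  apply/seteqP; split=> [_ [x Pax <-]|x Pax]; first by rewrite fixa.
  by exists x; rewrite ?fixa.
Qed.

End ClopenPartition.

(** The complement of the union of all translates of [U] is closed and invariant, and it misses [U],
    so minimality makes it empty. *)
Lemma minimal_orbit (X : topologicalType) (H : set (X -> X)) (U : set X) :
  homeo_group H -> acts_minimally H -> open U -> U !=set0 ->
  forall x, exists2 h, H h & (h @` U) x.
Proof.
move=> grH minH oU [u Uu] x; have [_ Hid Hcomp _] := grH.
pose O := \bigcup_(h in H) (h @` U).
suff OT : O = [set: X] by have : O x by rewrite OT.
have oO : open O.
  apply: bigcup_open => h Hh; exact: (homeo_group_image_open _ _ grH).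
have Oinv h y : H h -> O y -> O (h y).
  by move=> Hh [f Hf [z Uz <-]]; exists (h \o f); [exact: Hcomp|exists z].
have [||CO|CO] := minH (~` O).
- exact: open_closedC.
- move=> g Hg _ [y nOy <-] Ogy; have [g' [Hg' _ gK _]] := homeo_groupV _ _ grH _ Hg.
  by apply: nOy; rewrite -(gK y); exact: Oinv.
- by rewrite -[O]setCK CO setC0.
- have : [set: X] u by [].
  by rewrite -CO => -[]; exists id => //; exists u.
Qed.

(** * Good sets and the classes they define *)

Section GoodSets.
Variables (X : topologicalType) (G H : set (X -> X)).
Hypotheses (cantorX : cantor_set X) (grG : homeo_group G) (EG : property_E G).
Hypotheses (grH : homeo_group H) (HG : H `<=` G) (minH : acts_minimally H).
Hypothesis localH :
  exists U : set X, [/\ clopen U, U !=set0 & local_subgroup G U `<=` H].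

Definition good (V : set X) := clopen V /\ local_subgroup G V `<=` H.

Lemma goodU V1 V2 : good V1 -> good V2 -> V1 `&` V2 !=set0 -> good (V1 `|` V2).
Proof.
move=> [c1 g1] [c2 g2] V12; split; first exact: clopenU.
exact: property_E_sub.
Qed.

Lemma good_image h V : H h -> good V -> good (h @` V).
Proof.
move=> Hh [cV gV]; split; last exact: local_subgroup_image.
exact: (homeo_group_image_clopen _ _ grH).
Qed.

Lemma good_cover x : exists V, good V /\ V x.
Proof.
have [U [cU U0 UH]] := localH.
have [h Hh hUx] := minimal_orbit _ _ U grH minH cU.1 U0 x.
by exists (h @` U); split=> //; exact: good_image.
Qed.

Definition linked x : set X := [set y | exists V, [/\ good V, V x & V y]].

Lemma linked_refl x : linked x x.
Proof. by have [V [gV Vx]] := good_cover x; exists V. Qed.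

Lemma linked_sym x y : linked x y -> linked y x.
Proof. by move=> [V [gV Vx Vy]]; exists V. Qed.

Lemma linked_trans x y z : linked x y -> linked y z -> linked x z.
Proof.
move=> [V [gV Vx Vy]] [W [gW Wy Wz]]; exists (V `|` W); split; [|by left|by right].
by apply: goodU => //; exists y.
Qed.

Lemma linked_eq x y : linked x y -> linked x = linked y.
Proof.
move=> xy; apply/seteqP; split=> z; apply: linked_trans => //.
exact: linked_sym.
Qed.

Lemma good_sub_linked V x : good V -> V x -> V `<=` linked x.
Proof. by move=> gV Vx y Vy; exists V. Qed.

Lemma linked_image h x y : H h -> linked x y -> linked (h x) (h y).
Proof.
move=> Hh [V [gV Vx Vy]]; exists (h @` V).
by split; [exact: good_image|exists x|exists y].
Qed.

Lemma linked_finite : exists s : seq X, forall z, exists2 y, y \in s & linked y z.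
Proof.
have [V VP] := choice good_cover.
have [|x|s sP] := cantor_set_subcover _ cantorX V.
- by move=> x; have [[[]]] := VP x.
- by have [] := VP x.
exists s => z; have [y ys Vyz] := sP z; exists y => //.
by exists (V y); have [] := VP y.
Qed.

(** Starting from a good set around [x], those members of a finite good cover whose centers are
    linked to [x] are absorbed one at a time. The resulting good set [W] is the whole class. *)
Lemma good_linked x : good (linked x).
Proof.
have [V VP] := choice good_cover.
have [|y|s sP] := cantor_set_subcover _ cantorX V.
- by move=> y; have [[[]]] := VP y.
- by have [] := VP y.
have [W [gW Wx WV]] : exists W, [/\ good W, W x &
    forall y, y \in s -> linked x y -> V y `<=` W].
  elim: s {sP} => [|y s [W [gW Wx WV]]].
    by have [W [gW Wx]] := good_cover x; exists W.
  have [[Z [gZ Zx Zy]]|nxy] := pselect (linked x y); last first.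
    exists W; split=> // z; rewrite inE => /predU1P[-> /nxy//|]; exact: WV.
  have [gVy Vyy] := VP y.
  (* [Z] witnesses the link: it meets [W] at [x] and [V y] at [y], so both unions are good. *)
  exists (W `|` (Z `|` V y)); split; last 2 first.
  - by left.
  - move=> z; rewrite inE => /predU1P[-> _|zs xz] t Vt; first by right; right.
    by left; exact: WV Vt.
  apply: goodU => //; last by exists x; split=> //; left.
  by apply: goodU => //; exists y.
suff -> : linked x = W by [].
apply/seteqP; split=> [z xz|]; last exact: good_sub_linked.
have [y ys Vyz] := sP z; have [gVy Vyy] := VP y.
apply: (WV y) => //; apply: linked_trans xz _.
by exists (V y).
Qed.

Lemma linked_partition : exists (k : nat) (U : 'I_k -> set X),
  clopen_partition U /\ forall i, exists x, U i = linked x.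
Proof.
have [s sP] := linked_finite.
(* Removing repetitions makes distinct indices name distinct classes, as disjointness of the pieces
   requires. *)
pose t := undup [seq linked y | y <- s].
have tP (i : 'I_(size t)) : exists x, tnth (in_tuple t) i = linked x.
  have := mem_tnth i (in_tuple t).
  by rewrite mem_undup => /mapP[x _ ->]; exists x.
exists (size t), (tnth (in_tuple t)); split=> //; split; last first.
  by move=> i; have [x ->] := tP i; have [] := good_linked x.
split.
- apply/seteqP; split=> // z _; have [y ys yz] := sP z.
  have : linked y \in in_tuple t by rewrite mem_undup map_f.
  by move=> /tnthP[i iE]; exists i => //; rewrite -iE.
- move=> i j _ _ [z []]; have [x xE] := tP i; have [y yE] := tP j.
  rewrite xE yE => /linked_eq xz /linked_eq yz.
  have : tnth (in_tuple t) i = tnth (in_tuple t) j by rewrite xE yE xz yz.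
  by rewrite !(tnth_nth set0) => /eqP; rewrite nth_uniq ?undup_uniq// => /eqP/ord_inj.
- by move=> i _; have [x ->] := tP i; exists x; exact: linked_refl.
Qed.

End GoodSets.

(** The map equal to [h] on [C] and to the identity elsewhere is a homeomorphism, because [C] is
    clopen and [h]-invariant. It agrees with [h] or [id] near each point, so ampleness puts it in
    [G]. *)
Lemma ample_restrict (X : topologicalType) (G : set (X -> X)) (C : set X) h :
  homeo_group G -> ample G -> clopen C -> G h -> h @` C = C ->
  exists2 g, local_subgroup G C g & forall x, C x -> g x = h x.
Proof.
move=> grG aG cC Gh hC; have [h' [Gh' ch' hK h'K]] := homeo_groupV _ _ grG _ Gh.
have [GX Gid _ _] := grG; have [ch _] := GX _ Gh.
have Ch x : C x -> C (h x) by move=> Cx; rewrite -hC; exists x.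
have Ch' x : C x -> C (h' x).
  by move=> Cx; move: (Cx); rewrite -[X in X x]hC => -[y Cy <-]; rewrite hK.
pose r (f : X -> X) x := if pselect (C x) then f x else x.
have rC f x : C x -> r f x = f x by rewrite /r; case: pselect.
have rN f x : ~ C x -> r f x = x by rewrite /r; case: pselect.
have rcont f : continuous f -> continuous (r f).
  move=> cf x; have [Cx|nCx] := pselect (C x).
    have e : \forall y \near x, f y = r f y.
      by apply: filterS (open_nbhs_nbhs (conj cC.1 Cx)) => y Cy; rewrite rC.
    by rewrite /continuous_at rC//; exact: cvg_trans (near_eq_cvg e) (cf x).
  have oC : open (~` C) by apply: closed_openC; case: cC.
  have e : \forall y \near x, y = r f y.
    by apply: filterS (open_nbhs_nbhs (conj oC nCx)) => y nCy; rewrite rN.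
  by rewrite /continuous_at rN//; exact: (@near_eq_cvg _ _ _ _ id (r f) e).
have rK f g : (forall x, C x -> C (f x)) -> cancel f g -> cancel (r f) (r g).
  move=> Cf fK x; have [Cx|nCx] := pselect (C x); last by rewrite !rN.
  by rewrite (rC f)// rC ?fK//; exact: Cf.
exists (r h) => //; last by move=> x /rC.
split; last by move=> x /rN.
rewrite -aG; split.
  by split; [exact: rcont|exists (r h'); split; [exact: rcont|exact: rK|exact: rK]].
move=> x; have [Cx|nCx] := pselect (C x).
  by exists C; split=> //; [case: cC|exists h => // y /rC].
exists (~` C); split=> //; first by apply: closed_openC; case: cC.
by exists id => // y /rN.
Qed.

Theorem theorem1p6 (X : topologicalType) (G H : set (X -> X)) :
  cantor_set X ->
  homeo_group G -> ample G -> property_E G ->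
  maximal_subgroup G H -> acts_minimally H ->
  (exists U : set X, [/\ clopen U, U !=set0 & local_subgroup G U `<=` H]) ->
  exists (k : nat) (U : 'I_k -> set X),
    [/\ clopen_partition U,
        H = St G U,
        (forall (k' : nat) (U' : 'I_k' -> set X),
           clopen_partition U' -> H = St G U' -> range U' = range U),
        (2 <= k)%N &
        transitive_on_pieces H U].
Proof.
move=> cX grG aG EG [grH [HG HnG] maxH] minH localH.
have [k [U [partU Ul]]] := linked_partition X G H cX grG EG grH HG minH localH.
have [[_ _ neU] cU] := partU.
have UE i x : U i x -> U i = linked X G H x.
  by have [y ->] := Ul i; exact: linked_eq.
have goodUi i : good X G H (U i).
  by have [x ->] := Ul i; exact: good_linked.
have orbit a b : exists2 h, H h & exists2 x, U a x & U b (h x).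
  have [y Uby] := neU b I.
  have [h Hh [x Uax hxy]] := minimal_orbit _ _ _ grH minH (cU a).1 (neU a I) y.
  by exists h => //; exists x; rewrite ?hxy.
have HSt : H `<=` St G U.
  move=> h Hh; split=> [|i]; first exact: HG.
  have [x Uix] := neU i I; have [j Ujhx] := clopen_partition_cover _ _ _ partU (h x).
  exists j; rewrite (UE _ _ Uix) (UE _ _ Ujhx).
  have [h' [Hh' _ hK h'K]] := homeo_groupV _ _ grH _ Hh.
  apply/seteqP; split=> [_ [y xy <-]|y hxy]; first exact: linked_image.
  by exists (h' y); rewrite // -[x]hK; exact: linked_image.
have k2 : (2 <= k)%N.
  (* A single class would be all of [X]; being good, it would force [G] into [H]. *)
  rewrite leqNgt; apply/negP => k1; apply: HnG => g Gg.
  have [_ [_ [x _] _]] := localH.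
  have [i Uix] := clopen_partition_cover _ _ _ partU x.
  apply: (goodUi i).2; split=> // y nUy; exfalso; apply: nUy.
  have [j Ujy] := clopen_partition_cover _ _ _ partU y.
  suff -> : i = j by [].
  apply: ord_inj; have := ltn_ord i; have := ltn_ord j.
  by case: (k) k1 (i : nat) (j : nat) => [|[|]]// _ [|?] [|?].
have HE : H = St G U.
  apply: contrapT => HneSt; apply: maxH; exists (St G U); split.
  - exact: St_group.
  - by split=> // StH; apply: HneSt; apply/seteqP.
  - split=> [g []//|GSt].
    (* If the stabilizer were [G], all of [G] would preserve [U a], yet some [h] in [H] sends a
       point of [U a] into [U b]. *)
    pose a := Ordinal (ltnW k2); pose b := Ordinal k2.
    have nab : a <> b by move/(congr1 val).
    have [h Hh [x Uax Ubhx]] := orbit a b.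
    have hUa : h @` U a = U a.
      apply: (local_subgroup_preserves_piece _ _ _ partU G setT a b) => //.
      + exact: clopenT.
      + by move=> g [/GSt].
      + by split; [exact: HG|move=> z []].
    apply/nab/(clopen_partition_eq _ _ _ partU _ _ (h x)) => //.
    by rewrite -hUa; exists x.
exists k, U; split=> //; last first.
  move=> a b; have [h Hh [x Uax Ubhx]] := orbit a b.
  exists h => //; exact: St_image (HSt _ Hh) Uax Ubhx.
move=> k' U' partU' HE'; have [[_ _ neU'] cU'] := partU'.
(* A piece of any partition with stabilizer [H] is itself good, hence lies inside one class. *)
have sub i j x : U' j x -> U i x -> U' j `<=` U i.
  move=> U'jx Uix; rewrite (UE _ _ Uix); apply: good_sub_linked => //; split=> //.
  by rewrite HE'; exact: local_subgroup_piece_sub_St.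
have eqU i j x : U' j x -> U i x -> U' j = U i.
  move=> U'jx Uix; apply/seteqP; split=> [|y Uiy]; first exact: sub Uix.
  have [l U'ly] := clopen_partition_cover _ _ _ partU' y.
  have [->//|njl] := pselect (j = l).
  (* Here [U i] would contain two pieces [U' j] and [U' l]. As [h] sends [z] to [y] inside [U i], it
     preserves [U i], and its restriction [g] lies in the local subgroup over [U i]. That subgroup
     preserves [U' j], so [y], the image of [z] under [g], is in [U' j]. *)
  have [h Hh [z U'jz hzy]] := minimal_orbit _ _ _ grH minH (cU' j).1 (neU' j I) y.
  have hUi : h @` U i = U i.
    apply: (St_image _ _ _ partU _ _ _ _ z (HSt _ Hh)); last by rewrite hzy.
    exact: sub _ _ _ U'jx Uix _ U'jz.
  have [g Cg gh] := ample_restrict _ _ _ _ grG aG (cU i) (HG _ Hh) hUi.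
  have gU'j : g @` U' j = U' j.
    apply: (local_subgroup_preserves_piece _ _ _ partU' G (U i) j l) => //.
    + exact: sub Uix.
    + exact: sub Uiy.
    + by rewrite -HE'; case: (goodUi i).
  by rewrite -gU'j; exists z => //; rewrite gh//; exact: sub _ _ _ U'jx Uix _ U'jz.
apply/seteqP; split=> _ [j _ <-].
  have [x U'jx] := neU' j I; have [i Uix] := clopen_partition_cover _ _ _ partU x.
  by exists i; rewrite // (eqU i j x).
have [x Ujx] := neU j I; have [i U'ix] := clopen_partition_cover _ _ _ partU' x.
by exists i; rewrite // (eqU j i x).
Qed.
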